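(* Let $\gamma_1,\gamma_2>0$ be real numbers such that either $\gamma_1-\gamma_2-e(e+1)\geq e^2$ or $1-e(1+\gamma_1+\gamma_2)\geq e$. If $p$ is an analytic function in $\mathbb{D}$ such that $p(0)=1$ and $$p(z)+\gamma_1 zp'(z)+\gamma_2 z^2p''(z)\prec 1+ze^z,$$ then $p(z)\prec e^z$.
   Context: $\mathbb{D}=\{z\in\mathbb{C}:|z|<1\}$ is the open unit disk. For analytic functions $g,h$ on $\mathbb{D}$, $g\prec h$ ($g$ is subordinate to $h$) means that there is an analytic function $w:\mathbb{D}\to\mathbb{D}$ with $w(0)=0$ and $|w(z)|\le|z|$ such that $g(z)=h(w(z))$ for all $z\in\mathbb{D}$. *)

(* Defs.v *)
(* Stdlib world: Stdlib's real numbers and Coquelicot's complex numbers. *)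
From Stdlib Require Import Reals.
From Coquelicot Require Import Coquelicot.

Local Open Scope R_scope.

Definition unit_disk (z : C) : Prop := Cmod z < 1.

Definition Cexp (z : C) : C :=
  (exp (Re z) * cos (Im z), exp (Re z) * sin (Im z)).

(* The argument of [is_pseries] is the increment [y - x]: this is a power
   series centred at [x], with sum [f y] at every [y] near [x]. *)
Definition analytic_at (f : C -> C) (x : C) : Prop :=
  exists a : nat -> C,
    locally x (fun y : C =>
      is_pseries (K := C_AbsRing) (V := C_NormedModule) a (y - x)%C (f y)).

(* Functions on the disk are represented by functions on [C]; their values
   outside [D] are irrelevant, as [D] is only used when it is open. *)
Definition analytic_on (D : C -> Prop) (f : C -> C) : Prop :=
  forall z : C, D z -> analytic_at f z.

(* Meant for [g] and [h] analytic on the unit disk. *)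
Definition subordinate (g h : C -> C) : Prop :=
  exists w : C -> C,
    analytic_on unit_disk w /\
    (forall z : C, unit_disk z -> unit_disk (w z)) /\
    w 0%C = 0%C /\
    (forall z : C, unit_disk z -> Cmod (w z) <= Cmod z) /\
    (forall z : C, unit_disk z -> g z = h (w z)).

(* Main.v *)
Require Import Defs.
From Stdlib Require Import Reals Lra Lia.
From Coquelicot Require Import Coquelicot.
Local Open Scope R_scope.

(** For small [p - 1] the conclusion is cheap: if [Cmod (p z - 1) <= Cmod z / 3]
    on the disk, then [p] takes its values in the right half plane, the
    principal logarithm [w = Clog p] is analytic, [p = Cexp w], and
    [ln (1 - r) >= - r / (1 - r)] gives [Cmod w <= Cmod z]
    ([subordinate_Cexp_of_close]).  The condition on the parameters is strong
    enough to put [p] that close to 1.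

    The closeness comes from a maximum argument on rays, in place of the usual
    admissibility lemmas for subordination.  Fix [z] and let
    [U t = p (t z) - 1] and [W = U'] for real [t] in [[0, 1]].  The hypothesis
    reads [U + gamma1 t W + gamma2 t^2 W' = F] with [F = w exp w] at [t z], so
    that [Cmod (F t) <= e t Cmod z].  Let [N] be the maximum of [Cmod W],
    reached at [r].  Then [Cmod (U r) <= N r], and [W . W' >= 0] at [r] for the
    real scalar product of the plane, because [(Cmod W)^2] is maximal there.
    Taking the scalar product of the equation at [r] with [W r] and dividing by
    [r], one gets [gamma1 N <= e Cmod z + N].  Hence
    [Cmod (p z - 1) <= N <= e Cmod z / (gamma1 - 1)] ([euler_ode_bound],
    [euler_subordinate_bound]), and [gamma1 > 1 + 3 e].

    The analyticity of [Clog p] is obtained on power series.  If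
    [p = sum a_n h^n] near a point and [a_0] is not 0, the formal quotient [d]
    of the series of [p'] and [p] has geometrically bounded coefficients
    ([CPS_div_geom]).  Its primitive [W] starting at [Clog a_0] satisfies
    [W' p = p'], so that [p exp (- W)] is constant, equal to 1 ([CPS_exp_log]);
    near the centre [Im W] stays in [(- pi / 2, pi / 2)], so that
    [W = Clog p] ([analytic_at_Clog]). *)

(** * Absolutely summable complex series *)

Definition abs_summable (u : nat -> C) : Prop := ex_series (fun n => Cmod (u n)).
(** Summing the real and imaginary parts separately makes the sum a total
    function and gives access to the lemmas on real series, in particular to
    the Cauchy product. *)
Definition CSum (u : nat -> C) : C :=
  (Series (fun n => Re (u n)), Series (fun n => Im (u n))).

Lemma im_le_Cmod (z : C) : Rabs (Im z) <= Cmod z.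
Proof.
  apply Rle_trans with (2 := Rmax_Cmod z). apply Rmax_r.
Qed.

Lemma Cmod_le_Re_Im (z : C) : Cmod z <= Rabs (Re z) + Rabs (Im z).
Proof.
  destruct z as [x y]. unfold Cmod; simpl.
  pose proof (Rabs_pos x). pose proof (Rabs_pos y).
  apply Rsqr_incr_0_var; [|lra].
  rewrite Rsqr_sqrt by nra. unfold Rsqr.
  pose proof (Rsqr_abs x). pose proof (Rsqr_abs y). unfold Rsqr in *. nra.
Qed.

Lemma abs_summable_Re u : abs_summable u -> ex_series (fun n => Rabs (Re (u n))).
Proof.
  intros H. apply (@ex_series_le R_AbsRing R_CompleteNormedModule _ (fun n => Cmod (u n))); [|exact H].
  intros n. change (Rabs (Rabs (Re (u n))) <= Cmod (u n)).
  rewrite Rabs_Rabsolu. apply re_le_Cmod.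
Qed.

Lemma abs_summable_Im u : abs_summable u -> ex_series (fun n => Rabs (Im (u n))).
Proof.
  intros H. apply (@ex_series_le R_AbsRing R_CompleteNormedModule _ (fun n => Cmod (u n))); [|exact H].
  intros n. change (Rabs (Rabs (Im (u n))) <= Cmod (u n)).
  rewrite Rabs_Rabsolu. apply im_le_Cmod.
Qed.

Lemma abs_summable_le (u : nat -> C) (v : nat -> R) :
  (forall n, Cmod (u n) <= v n) -> ex_series v -> abs_summable u.
Proof.
  intros H Hv. apply (@ex_series_le R_AbsRing R_CompleteNormedModule _ v); [|exact Hv].
  intros n. change (Rabs (Cmod (u n)) <= v n).
  rewrite Rabs_pos_eq by apply Cmod_ge_0. apply H.
Qed.

Lemma sum_n_pair (u : nat -> C) N :
  sum_n (G := C_AbelianMonoid) u N = (sum_n (fun n => Re (u n)) N, sum_n (fun n => Im (u n)) N).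
Proof.
  induction N as [|N IH].
  - rewrite !sum_O. destruct (u 0%nat); reflexivity.
  - rewrite !sum_Sn, IH. destruct (u (S N)); reflexivity.
Qed.

Lemma is_series_pair (u : nat -> C) (l : C) :
  is_series (K := C_AbsRing) (V := C_NormedModule) u l <->
  is_series (fun n => Re (u n)) (Re l) /\ is_series (fun n => Im (u n)) (Im l).
Proof.
  unfold is_series. split.
  - intros H. split; apply filterlim_locally; intros eps;
    pose proof (proj1 (filterlim_locally _ _) H eps) as H';
    revert H'; apply filter_imp; intros N HN;
    change (ball (M := C_UniformSpace) l eps (sum_n (G := C_AbelianMonoid) u N)) in HN;
    rewrite sum_n_pair in HN; apply HN.
  - intros [H1 H2]. apply filterlim_locally; intros eps.
    pose proof (proj1 (filterlim_locally _ _) H1 eps) as H1'.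
    pose proof (proj1 (filterlim_locally _ _) H2 eps) as H2'.
    generalize (filter_and _ _ H1' H2'). apply filter_imp; intros N [A B].
    change (ball (M := C_UniformSpace) l eps (sum_n (G := C_AbelianMonoid) u N)).
    rewrite sum_n_pair. split; [exact A|exact B].
Qed.

Lemma CSum_unique u l : is_series (K := C_AbsRing) (V := C_NormedModule) u l -> CSum u = l.
Proof.
  intros H. apply is_series_pair in H as [H1 H2]. unfold CSum.
  rewrite (is_series_unique _ _ H1), (is_series_unique _ _ H2). now destruct l.
Qed.

Lemma CSum_correct u : abs_summable u -> is_series (K := C_AbsRing) (V := C_NormedModule) u (CSum u).
Proof.
  intros H. apply is_series_pair. split; apply Series_correct, ex_series_Rabs.
  - now apply abs_summable_Re.
  - now apply abs_summable_Im.
Qed.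

(** The factor 2 is the price of bounding the real and imaginary parts
    separately; only the order of magnitude matters in the sequel. *)
Lemma CSum_le u v : (forall n, Cmod (u n) <= v n) -> ex_series v -> Cmod (CSum u) <= 2 * Series v.
Proof.
  intros H Hv. pose proof (abs_summable_le _ _ H Hv) as Hu.
  eapply Rle_trans; [apply Cmod_le_Re_Im|].
  assert (Rabs (Re (CSum u)) <= Series v).
  { eapply Rle_trans; [apply Series_Rabs; now apply abs_summable_Re|].
    apply Series_le; [|exact Hv]. intros n; split; [apply Rabs_pos|].
    eapply Rle_trans; [apply re_le_Cmod|apply H]. }
  assert (Rabs (Im (CSum u)) <= Series v).
  { eapply Rle_trans; [apply Series_Rabs; now apply abs_summable_Im|].
    apply Series_le; [|exact Hv]. intros n; split; [apply Rabs_pos|].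
    eapply Rle_trans; [apply im_le_Cmod|apply H]. }
  lra.
Qed.

Lemma CSum_ext u v : (forall n, u n = v n) -> CSum u = CSum v.
Proof.
  intros H. unfold CSum. f_equal; apply Series_ext; intros n; now rewrite H.
Qed.

Lemma CSum_plus u v : abs_summable u -> abs_summable v ->
  CSum (fun n => u n + v n)%C = (CSum u + CSum v)%C.
Proof.
  intros Hu Hv. apply CSum_unique.
  apply (is_series_plus (K := C_AbsRing) (V := C_NormedModule)); now apply CSum_correct.
Qed.

Lemma CSum_scal c u : abs_summable u ->
  CSum (fun n => c * u n)%C = (c * CSum u)%C.
Proof.
  intros Hu. apply CSum_unique.
  apply (is_series_scal (K := C_AbsRing) (V := C_NormedModule)); now apply CSum_correct.
Qed.

Lemma abs_summable_plus u v : abs_summable u -> abs_summable v ->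
  abs_summable (fun n => u n + v n)%C.
Proof.
  intros Hu Hv. eapply abs_summable_le. 2: exact (ex_series_plus _ _ Hu Hv).
  intros n. apply Cmod_triangle.
Qed.

Lemma abs_summable_scal c u : abs_summable u -> abs_summable (fun n => c * u n)%C.
Proof.
  intros Hu. eapply abs_summable_le. 2: exact (ex_series_scal (V := R_NormedModule) (Cmod c) _ Hu).
  intros n. rewrite Cmod_mult. apply Rle_refl.
Qed.

Lemma CSum_incr_1 u : abs_summable u -> CSum u = (u 0%nat + CSum (fun n => u (S n)))%C.
Proof.
  intros Hu. unfold CSum.
  rewrite (Series_incr_1 (fun n => Re (u n))) by (apply ex_series_Rabs; now apply abs_summable_Re).
  rewrite (Series_incr_1 (fun n => Im (u n))) by (apply ex_series_Rabs; now apply abs_summable_Im).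
  reflexivity.
Qed.

Definition Cconv (u v : nat -> C) (n : nat) : C :=
  sum_n (G := C_AbelianMonoid) (fun k => u k * v (n - k)%nat)%C n.

Lemma Re_sum_n (u : nat -> C) N : Re (sum_n (G := C_AbelianMonoid) u N) = sum_f_R0 (fun n => Re (u n)) N.
Proof. rewrite sum_n_pair. simpl. apply sum_n_Reals. Qed.
Lemma Im_sum_n (u : nat -> C) N : Im (sum_n (G := C_AbelianMonoid) u N) = sum_f_R0 (fun n => Im (u n)) N.
Proof. rewrite sum_n_pair. simpl. apply sum_n_Reals. Qed.

Lemma CSum_mult u v : abs_summable u -> abs_summable v ->
  CSum (Cconv u v) = (CSum u * CSum v)%C.
Proof.
  intros Hu Hv. apply CSum_unique, is_series_pair.
  pose proof (abs_summable_Re _ Hu) as Ru. pose proof (abs_summable_Im _ Hu) as Iu.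
  pose proof (abs_summable_Re _ Hv) as Rv. pose proof (abs_summable_Im _ Hv) as Iv.
  pose proof (Series_correct _ (ex_series_Rabs _ Ru)) as SRu.
  pose proof (Series_correct _ (ex_series_Rabs _ Iu)) as SIu.
  pose proof (Series_correct _ (ex_series_Rabs _ Rv)) as SRv.
  pose proof (Series_correct _ (ex_series_Rabs _ Iv)) as SIv.
  pose proof (is_series_mult _ _ _ _ SRu SRv Ru Rv) as RR.
  pose proof (is_series_mult _ _ _ _ SIu SIv Iu Iv) as II.
  pose proof (is_series_mult _ _ _ _ SRu SIv Ru Iv) as RI.
  pose proof (is_series_mult _ _ _ _ SIu SRv Iu Rv) as IR.
  split.
  - eapply is_series_ext; [|exact (is_series_minus _ _ _ _ RR II)].
    intros n. unfold Cconv. rewrite Re_sum_n. simpl.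
    change (sum_f_R0 (fun k => Re (u k) * Re (v (n-k)%nat)) n
      - sum_f_R0 (fun k => Im (u k) * Im (v (n-k)%nat)) n
      = sum_f_R0 (fun k => Re (u k * v (n-k)%nat)%C) n).
    rewrite <- minus_sum. apply sum_eq. intros; reflexivity.
  - eapply is_series_ext; [|exact (is_series_plus _ _ _ _ RI IR)].
    intros n. unfold Cconv. rewrite Im_sum_n. simpl.
    change (sum_f_R0 (fun k => Re (u k) * Im (v (n-k)%nat)) n
      + sum_f_R0 (fun k => Im (u k) * Re (v (n-k)%nat)) n
      = sum_f_R0 (fun k => Im (u k * v (n-k)%nat)%C) n).
    rewrite <- sum_plus. apply sum_eq. intros; reflexivity.
Qed.

(** * Complex power series with geometrically bounded coefficients *)

(** Positive radius of convergence with explicit constants: the recursive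
    constructions on coefficients below are controlled in this form. *)
Definition geom_bounded (a : nat -> C) (M K : R) : Prop :=
  0 <= M /\ 0 < K /\ forall n, Cmod (a n) <= M * K ^ n.

Definition CPSeries (a : nat -> C) (h : C) : C := CSum (fun n => a n * h ^ n)%C.

Definition CPS_derive (a : nat -> C) (n : nat) : C := (INR (S n) * a (S n))%C.

(** Complex differentiability with a quadratic error.  Power series satisfy it,
    and it restricts to lines without any filter manipulation. *)
Definition quad_derive (f : C -> C) (z l : C) : Prop :=
  exists d B, 0 < d /\ 0 <= B /\
    forall k, Cmod k < d -> Cmod (f (z + k) - f z - k * l)%C <= B * Cmod k ^ 2.

Lemma ex_series_geom_scal M q : 0 <= q < 1 -> ex_series (fun n => M * q ^ n).
Proof.
  intros Hq. apply (ex_series_scal (V := R_NormedModule) M).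
  apply ex_series_geom. rewrite Rabs_pos_eq; lra.
Qed.

Lemma Series_geom_scal M q : 0 <= q < 1 -> Series (fun n => M * q ^ n) = M / (1 - q).
Proof.
  intros Hq. rewrite Series_scal_l, Series_geom; [reflexivity|].
  rewrite Rabs_pos_eq; lra.
Qed.

Lemma CPS_term_le a M K h : geom_bounded a M K ->
  forall n, Cmod (a n * h ^ n)%C <= M * (K * Cmod h) ^ n.
Proof.
  intros (HM & HK & Ha) n. rewrite Cmod_mult, Cmod_pow, Rpow_mult_distr, <- Rmult_assoc.
  apply Rmult_le_compat_r; [apply pow_le, Cmod_ge_0|apply Ha].
Qed.

Lemma CPS_summable a M K h : geom_bounded a M K -> K * Cmod h < 1 ->
  abs_summable (fun n => a n * h ^ n)%C.
Proof.
  intros Ha Hh. eapply abs_summable_le; [apply (CPS_term_le a M K h Ha)|].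
  apply ex_series_geom_scal. split; [|exact Hh].
  apply Rmult_le_pos; [apply Rlt_le, Ha|apply Cmod_ge_0].
Qed.

Lemma INR_le_pow2 n : INR n <= 2 ^ n.
Proof.
  induction n as [|n IH]; [simpl; lra|].
  rewrite S_INR. simpl. assert (1 <= 2 ^ n) by (apply pow_R1_Rle; lra). lra.
Qed.

Lemma geom_bounded_CPS_derive a M K : geom_bounded a M K -> geom_bounded (CPS_derive a) (2 * M * K) (2 * K).
Proof.
  intros (HM & HK & Ha). repeat split; try nra.
  intros n. unfold CPS_derive. rewrite Cmod_mult, Cmod_R, Rabs_pos_eq by apply pos_INR.
  replace (2 * M * K * (2 * K) ^ n) with (2 ^ S n * (M * K ^ S n)).
  - apply Rmult_le_compat; [apply pos_INR|apply Cmod_ge_0|apply INR_le_pow2|apply Ha].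
  - rewrite Rpow_mult_distr. simpl. ring.
Qed.

(** The derivative of [h ^ n], with the value 0 for [n = 0]: the derived series
    can then be written with the same index as the original one. *)
Definition pow_deriv (h : C) (n : nat) : C :=
  match n with O => 0%C | S m => (INR (S m) * h ^ m)%C end.

(** The factor [s], like [s ^ 2] in the next lemma, avoids the exponents
    [n - 1] and [n - 2]. *)
Lemma pow_deriv_le h s n : Cmod h <= s -> s * Cmod (pow_deriv h n) <= INR n * s ^ n.
Proof.
  intros Hs. pose proof (Cmod_ge_0 h). destruct n as [|m]; unfold pow_deriv.
  - rewrite Cmod_0. simpl. lra.
  - rewrite Cmod_mult, Cmod_R, Cmod_pow, Rabs_pos_eq by apply pos_INR.
    replace (INR (S m) * s ^ S m) with (s * (INR (S m) * s ^ m)) by (simpl; ring).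
    apply Rmult_le_compat_l; [lra|]. apply Rmult_le_compat_l; [apply pos_INR|].
    apply pow_incr; lra.
Qed.

(** With [D_n] the difference on the left,
    [D_(n+1) = (h + k) D_n + k ^ 2 * pow_deriv h n], and the bound follows by
    induction from [n ^ 2 + n <= (n + 1) ^ 2]. *)
Lemma pow_taylor2 h k s n : Cmod h <= s -> Cmod (h + k)%C <= s ->
  s ^ 2 * Cmod ((h + k) ^ n - h ^ n - k * pow_deriv h n)%C <= INR n ^ 2 * s ^ n * Cmod k ^ 2.
Proof.
  intros Hh Hk. pose proof (Cmod_ge_0 h). induction n as [|n IH].
  - simpl. replace (1 - 1 - k * 0)%C with (RtoC 0) by ring. rewrite Cmod_0. nra.
  - set (D := ((h + k) ^ n - h ^ n - k * pow_deriv h n)%C) in *.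
    assert (E : ((h + k) ^ S n - h ^ S n - k * pow_deriv h (S n) = (h + k) * D + k ^ 2 * pow_deriv h n)%C).
    { unfold D. destruct n as [|m].
      - simpl. ring.
      - unfold pow_deriv. rewrite (S_INR (S m)), RtoC_plus. simpl Cpow. ring. }
    rewrite E.
    assert (T := pow_deriv_le h s n Hh).
    assert (Cmod ((h + k) * D + k ^ 2 * pow_deriv h n)%C <= s * Cmod D + Cmod k ^ 2 * Cmod (pow_deriv h n)).
    { eapply Rle_trans; [apply Cmod_triangle|]. rewrite !Cmod_mult, Cmod_pow.
      apply Rplus_le_compat; [|simpl; lra]. apply Rmult_le_compat_r; [apply Cmod_ge_0|exact Hk]. }
    assert (0 <= s) by lra.
    apply Rle_trans with (s * (s ^ 2 * Cmod D) + s * Cmod k ^ 2 * (s * Cmod (pow_deriv h n))).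
    { apply Rle_trans with (s ^ 2 * (s * Cmod D + Cmod k ^ 2 * Cmod (pow_deriv h n))).
      - apply Rmult_le_compat_l; [nra|assumption].
      - right; ring. }
    apply Rle_trans with (s * (INR n ^ 2 * s ^ n * Cmod k ^ 2) + s * Cmod k ^ 2 * (INR n * s ^ n)).
    { apply Rplus_le_compat; apply Rmult_le_compat_l; try assumption.
      apply Rmult_le_pos; [lra|apply pow2_ge_0]. }
    rewrite S_INR. simpl (s ^ S n).
    assert (0 <= s * s ^ n * Cmod k ^ 2).
    { apply Rmult_le_pos; [apply Rmult_le_pos; [lra|now apply pow_le]|apply pow2_ge_0]. }
    pose proof (pos_INR n). nra.
Qed.

Lemma INR2_le_pow4 n : INR n ^ 2 <= 4 ^ n.
Proof.
  pose proof (INR_le_pow2 n). pose proof (pos_INR n).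
  replace (4 ^ n) with (2 ^ n * 2 ^ n) by (rewrite <- Rpow_mult_distr; f_equal; lra).
  simpl; nra.
Qed.

Lemma INR_le_pow4 n : INR n <= 4 ^ n.
Proof.
  eapply Rle_trans; [|apply INR2_le_pow4]. destruct n as [|n]; [simpl; lra|].
  rewrite S_INR. pose proof (pos_INR n). nra.
Qed.

Lemma half_pow_of_radius K s n : K * s = / 8 -> K ^ n * 4 ^ n * s ^ n = (/ 2) ^ n.
Proof.
  intros H. rewrite <- !Rpow_mult_distr. f_equal. replace (K * 4 * s) with (4 * (K * s)) by ring.
  rewrite H. lra.
Qed.

(** Termwise differentiation: the second-order Taylor errors of the monomials,
    weighted by the coefficients, are summable.  Far inside the disk of
    convergence, within the radius [s = 1 / (8 K)], the weights [n ^ 2 <= 4 ^ n] still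
    leave a geometric series of ratio 1/2. *)
Lemma CPS_quad_derive a M K h : geom_bounded a M K -> 16 * K * Cmod h < 1 ->
  quad_derive (CPSeries a) h (CPSeries (CPS_derive a) h).
Proof.
  intros Ha Hh. pose proof Ha as (HM & HK & Hn).
  set (s := / (8 * K)).
  assert (Hs : 0 < s) by (apply Rinv_0_lt_compat; lra).
  assert (HKs : K * s = / 8) by (unfold s; field; lra).
  assert (Hhs : Cmod h <= s / 2).
  { apply Rmult_le_reg_l with K; [lra|]. replace (K * (s / 2)) with (/ 16) by nra. lra. }
  exists (s / 2), (4 * M / s ^ 2). repeat split; [lra| |].
  { apply Rmult_le_pos; [nra|]. left. apply Rinv_0_lt_compat. nra. }
  intros k Hk.
  assert (Hy : Cmod (h + k)%C <= s).
  { eapply Rle_trans; [apply Cmod_triangle|lra]. }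
  assert (Sh : abs_summable (fun n => a n * h ^ n)%C) by (apply (CPS_summable a M K); [exact Ha|nra]).
  assert (Sy : abs_summable (fun n => a n * (h + k) ^ n)%C) by (apply (CPS_summable a M K); [exact Ha|nra]).
  assert (Hhalf : 0 <= / 2 < 1) by lra.
  assert (St : abs_summable (fun n => a n * pow_deriv h n)%C).
  { eapply abs_summable_le with (v := fun n => M / s * (/ 2) ^ n); [|now apply ex_series_geom_scal].
    intros n. rewrite Cmod_mult.
    rewrite <- (half_pow_of_radius K s n HKs).
    apply Rle_trans with (M * K ^ n * (INR n * s ^ n / s)).
    - apply Rmult_le_compat; try apply Cmod_ge_0; [apply Hn|].
      apply Rmult_le_reg_l with s; [lra|].
      replace (s * (INR n * s ^ n / s)) with (INR n * s ^ n) by (field; lra).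
      apply pow_deriv_le. lra.
    - replace (M / s * (K ^ n * 4 ^ n * s ^ n)) with (M * K ^ n * (4 ^ n * s ^ n / s)) by (field; lra).
      apply Rmult_le_compat_l; [apply Rmult_le_pos; [lra|apply pow_le; lra]|].
      apply Rmult_le_compat_r; [left; now apply Rinv_0_lt_compat|].
      apply Rmult_le_compat_r; [apply pow_le; lra|apply INR_le_pow4]. }
  assert (E : (CPSeries a (h + k) - CPSeries a h - k * CPSeries (CPS_derive a) h)%C =
    CSum (fun n => a n * ((h + k) ^ n - h ^ n - k * pow_deriv h n))%C).
  { assert (E1 : CPSeries (CPS_derive a) h = CSum (fun n => a n * pow_deriv h n)%C).
    { rewrite (CSum_incr_1 _ St). unfold CPSeries.
      replace (a 0%nat * pow_deriv h 0)%C with (RtoC 0) by (unfold pow_deriv; ring). rewrite Cplus_0_l.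
      apply CSum_ext. intros n. unfold CPS_derive, pow_deriv. ring. }
    rewrite E1. unfold CPSeries.
    transitivity (CSum (fun n => a n * (h + k) ^ n) + (- (1)) * CSum (fun n => a n * h ^ n)
      + (- k) * CSum (fun n => a n * pow_deriv h n))%C; [ring|].
    rewrite <- !CSum_scal, <- !CSum_plus by
      repeat first [assumption|apply abs_summable_scal|apply abs_summable_plus].
    apply CSum_ext. intros n. ring. }
  rewrite E.
  eapply Rle_trans; [apply CSum_le with (v := fun n => (M / s ^ 2 * Cmod k ^ 2) * (/ 2) ^ n)|].
  - intros n. rewrite Cmod_mult, <- (half_pow_of_radius K s n HKs).
    apply Rle_trans with (M * K ^ n * (INR n ^ 2 * s ^ n * Cmod k ^ 2 / s ^ 2)).
    + apply Rmult_le_compat; try apply Cmod_ge_0; [apply Hn|].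
      apply Rmult_le_reg_l with (s ^ 2); [nra|].
      replace (s ^ 2 * (INR n ^ 2 * s ^ n * Cmod k ^ 2 / s ^ 2)) with (INR n ^ 2 * s ^ n * Cmod k ^ 2)
        by (field; lra).
      apply pow_taylor2; lra.
    + replace (M / s ^ 2 * Cmod k ^ 2 * (K ^ n * 4 ^ n * s ^ n))
        with (M * K ^ n * (4 ^ n * s ^ n * Cmod k ^ 2 / s ^ 2)) by (field; lra).
      apply Rmult_le_compat_l; [apply Rmult_le_pos; [lra|apply pow_le; lra]|].
      apply Rmult_le_compat_r; [left; apply Rinv_0_lt_compat; nra|].
      apply Rmult_le_compat_r; [apply pow2_ge_0|].
      apply Rmult_le_compat_r; [apply pow_le; lra|apply INR2_le_pow4].
  - now apply ex_series_geom_scal.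
  - rewrite Series_geom_scal by assumption. right. field. lra.
Qed.

Lemma geom_bounded_weaken a M K M' K' : geom_bounded a M K -> M <= M' -> K <= K' -> geom_bounded a M' K'.
Proof.
  intros (HM & HK & Ha) H H'. repeat split; try lra.
  intros n. eapply Rle_trans; [apply Ha|].
  apply Rmult_le_compat; [lra|apply pow_le; lra|lra|]. apply pow_incr. lra.
Qed.

(** * Analytic functions and their local power series *)

Lemma pow_n_Cpow (x : C) n : pow_n (K := C_Ring) x n = (x ^ n)%C.
Proof. induction n as [|n IH]; [reflexivity|]. simpl. rewrite IH. reflexivity. Qed.

Lemma is_pseries_C (a : nat -> C) (h l : C) :
  is_pseries (K := C_AbsRing) (V := C_NormedModule) a h l <->
  is_series (K := C_AbsRing) (V := C_NormedModule) (fun n => a n * h ^ n)%C l.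
Proof.
  unfold is_pseries.
  assert (E : forall n, scal (V := C_NormedModule) (pow_n (K := C_AbsRing) h n) (a n) = (a n * h ^ n)%C).
  { intros n. change (pow_n (K := C_Ring) h n * a n = a n * h ^ n)%C. rewrite pow_n_Cpow. apply Cmult_comm. }
  split; apply is_series_ext; intros n; now rewrite E.
Qed.

Lemma series_terms_bounded (u : nat -> R) : ex_series u -> exists M, forall n, Rabs (u n) <= M.
Proof.
  intros H. destruct (filterlim_bounded (K := R_AbsRing) (V := R_NormedModule) u) as [M HM].
  - exists 0. exact (ex_series_lim_0 _ H).
  - now exists M.
Qed.

(** The terms of a convergent series are bounded, so that convergence at one
    point [r > 0] bounds the coefficients by a multiple of [(/ r) ^ n].  The
    radius [d] is taken small enough for [CPS_quad_derive] to apply. *)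
Lemma analytic_at_CPSeries (f : C -> C) (x : C) : analytic_at f x ->
  exists a M K d, geom_bounded a M K /\ 0 < d /\ 16 * K * d <= 1 /\
    forall h, Cmod h < d -> f (x + h)%C = CPSeries a h.
Proof.
  intros [a [eps Ha]].
  assert (Hs : forall h, Cmod h < eps ->
     is_series (K := C_AbsRing) (V := C_NormedModule) (fun n => a n * h ^ n)%C (f (x + h)%C)).
  { intros h Hh. apply is_pseries_C. replace h with (x + h - x)%C at 1 by ring. apply Ha.
    apply C_NormedModule_mixin_compat1.
    change (Cmod (x + h - x)%C < eps). now replace (x + h - x)%C with h by ring. }
  pose proof (cond_pos eps) as Heps.
  set (r := eps / 2). assert (Hr : 0 < r) by (unfold r; lra).
  assert (Hr' : Cmod (RtoC r) < eps) by (rewrite Cmod_R, Rabs_pos_eq; unfold r; lra).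
  apply Hs, is_series_pair in Hr' as [H1 H2].
  destruct (series_terms_bounded _ (ex_intro _ _ H1)) as [M1 HM1].
  destruct (series_terms_bounded _ (ex_intro _ _ H2)) as [M2 HM2].
  assert (Hb : geom_bounded a (M1 + M2) (/ r)).
  { repeat split.
    - generalize (HM1 0%nat) (HM2 0%nat) (Rabs_pos (Re (a 0%nat * r ^ 0)%C))
        (Rabs_pos (Im (a 0%nat * r ^ 0)%C)). lra.
    - now apply Rinv_0_lt_compat.
    - intros n. rewrite pow_inv. apply Rmult_le_reg_r with (r ^ n); [now apply pow_lt|].
      rewrite Rmult_assoc, Rinv_l, Rmult_1_r by (apply pow_nonzero; lra).
      replace (Cmod (a n) * r ^ n) with (Cmod (a n * r ^ n)%C).
      + eapply Rle_trans; [apply Cmod_le_Re_Im|]. apply Rplus_le_compat; [apply HM1|apply HM2].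
      + rewrite Cmod_mult, Cmod_pow, Cmod_R, Rabs_pos_eq by lra. reflexivity. }
  exists a, (M1 + M2), (/ r), (r / 16). repeat split; try apply Hb.
  - lra.
  - right. field. lra.
  - intros h Hh. symmetry. apply CSum_unique, Hs. unfold r in *. lra.
Qed.

Lemma CPS_analytic_at f x a M K d : geom_bounded a M K -> 0 < d ->
  (forall h, Cmod h < d -> f (x + h)%C = CPSeries a h) -> analytic_at f x.
Proof.
  intros Ha Hd Hf. pose proof Ha as (_ & HK & _).
  set (e := Rmin d (/ K) / 2).
  assert (He : 0 < Rmin d (/ K)) by (apply Rmin_pos; [lra|now apply Rinv_0_lt_compat]).
  assert (He' : 0 < e) by (unfold e; lra).
  exists a, (mkposreal e He'). intros y [Hy1 Hy2].
  assert (Hy : Cmod (y - x)%C < Rmin d (/ K)).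
  { eapply Rle_lt_trans; [apply Cmod_le_Re_Im|].
    change (Rabs (Re (y - x)%C) < e) in Hy1. change (Rabs (Im (y - x)%C) < e) in Hy2. unfold e in *. lra. }
  apply is_pseries_C. replace (f y) with (f (x + (y - x))%C) by (f_equal; ring).
  rewrite Hf by (eapply Rlt_le_trans; [exact Hy|apply Rmin_l]).
  apply CSum_correct, (CPS_summable a M K); [exact Ha|].
  apply Rmult_lt_reg_l with (/ K); [now apply Rinv_0_lt_compat|].
  rewrite <- Rmult_assoc, Rinv_l, Rmult_1_l, Rmult_1_r by lra.
  eapply Rlt_le_trans; [exact Hy|apply Rmin_r].
Qed.

Lemma quad_derive_is_derive f z l : quad_derive f z l ->
  is_derive (K := C_AbsRing) (V := C_NormedModule) f z l.
Proof.
  intros (d & B & Hd & HB & H). split; [apply is_linear_scal_l|].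
  intros x Hx. apply (is_filter_lim_locally_unique (V := AbsRing_NormedModule C_AbsRing) z x) in Hx.
  rewrite <- Hx. clear x Hx.
  intros eps. pose proof (cond_pos eps) as Heps.
  assert (He : 0 < Rmin d (eps / (B + 1))).
  { apply Rmin_pos; [lra|]. apply Rdiv_lt_0_compat; lra. }
  exists (mkposreal _ He). intros y Hy.
  change (Cmod (y - z)%C < Rmin d (eps / (B + 1))) in Hy.
  change (Cmod (f y - f z - (y - z) * l)%C <= eps * Cmod (y - z)%C).
  set (k := (y - z)%C) in *. replace y with (z + k)%C by (unfold k; ring).
  eapply Rle_trans; [apply H; eapply Rlt_le_trans; [exact Hy|apply Rmin_l]|].
  assert (Hy' : Cmod k < eps / (B + 1)) by (eapply Rlt_le_trans; [exact Hy|apply Rmin_r]).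
  pose proof (Cmod_ge_0 k).
  assert (Cmod k * (B + 1) < eps).
  { apply Rmult_lt_reg_r with (/ (B + 1)); [apply Rinv_0_lt_compat; lra|].
    rewrite Rmult_assoc, Rinv_r by lra. unfold Rdiv in Hy'. lra. }
  simpl. nra.
Qed.

Lemma quad_derive_C_derive f z l : quad_derive f z l -> C_derive f z = l.
Proof. intros H. apply is_C_derive_unique. now apply quad_derive_is_derive. Qed.

(** The derivative is found at all points near the centre, and not only at the
    centre: this is what makes the derivative analytic again. *)
Lemma CPS_local_quad_derive f x a M K d : geom_bounded a M K -> 16 * K * d <= 1 ->
  (forall h, Cmod h < d -> f (x + h)%C = CPSeries a h) ->
  forall h, Cmod h < d -> quad_derive f (x + h)%C (CPSeries (CPS_derive a) h).
Proof.
  intros Ha Hd Hf h Hh. pose proof Ha as (_ & HK & _).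
  assert (D : quad_derive (CPSeries a) h (CPSeries (CPS_derive a) h)).
  { apply (CPS_quad_derive a M K); [exact Ha|]. nra. }
  destruct D as (d' & B & Hd' & HB & H).
  exists (Rmin d' (d - Cmod h)), B. repeat split; [apply Rmin_pos; lra|exact HB|].
  intros k Hk. rewrite <- Cplus_assoc, !Hf.
  - apply H. eapply Rlt_le_trans; [exact Hk|apply Rmin_l].
  - exact Hh.
  - eapply Rle_lt_trans; [apply Cmod_triangle|].
    assert (Cmod k < d - Cmod h) by (eapply Rlt_le_trans; [exact Hk|apply Rmin_r]). lra.
Qed.

Lemma analytic_at_quad_derive f x : analytic_at f x -> quad_derive f x (C_derive f x).
Proof.
  intros H. destruct (analytic_at_CPSeries f x H) as (a & M & K & d & Ha & Hd & HKd & Hf).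
  assert (D : quad_derive f x (CPSeries (CPS_derive a) 0)).
  { rewrite <- (Cplus_0_r x) at 1. apply (CPS_local_quad_derive f x a M K d Ha HKd Hf).
    now rewrite Cmod_0. }
  now rewrite (quad_derive_C_derive _ _ _ D).
Qed.

Lemma analytic_at_C_derive f x : analytic_at f x -> analytic_at (C_derive f) x.
Proof.
  intros H. destruct (analytic_at_CPSeries f x H) as (a & M & K & d & Ha & Hd & HKd & Hf).
  apply (CPS_analytic_at _ _ _ _ _ d (geom_bounded_CPS_derive a M K Ha) Hd).
  intros h Hh. apply quad_derive_C_derive. now apply (CPS_local_quad_derive f x a M K d Ha HKd Hf).
Qed.

Lemma quad_derive_close f z l eps : quad_derive f z l -> 0 < eps ->
  exists d, 0 < d /\ forall k, Cmod k < d -> Cmod (f (z + k) - f z)%C < eps.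
Proof.
  intros (d & B & Hd & HB & H) Heps.
  set (Q := B + Cmod l + 1). pose proof (Cmod_ge_0 l).
  assert (HQ : 0 < Q) by (unfold Q; lra).
  exists (Rmin d (Rmin 1 (eps / Q))).
  assert (0 < eps / Q) by (apply Rdiv_lt_0_compat; lra).
  split; [repeat apply Rmin_pos; lra|].
  intros k Hk.
  assert (K1 : Cmod k < d) by (eapply Rlt_le_trans; [exact Hk|apply Rmin_l]).
  assert (K2 : Cmod k < Rmin 1 (eps / Q)) by (eapply Rlt_le_trans; [exact Hk|apply Rmin_r]).
  assert (K3 : Cmod k < 1) by (eapply Rlt_le_trans; [exact K2|apply Rmin_l]).
  assert (K4 : Cmod k < eps / Q) by (eapply Rlt_le_trans; [exact K2|apply Rmin_r]).
  specialize (H k K1).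
  replace (f (z + k) - f z)%C with ((f (z + k) - f z - k * l) + k * l)%C by ring.
  eapply Rle_lt_trans; [apply Cmod_triangle|]. rewrite Cmod_mult.
  pose proof (Cmod_ge_0 k).
  assert (Cmod k * Q < eps).
  { apply Rmult_lt_reg_r with (/ Q); [now apply Rinv_0_lt_compat|].
    rewrite Rmult_assoc, Rinv_r by lra. unfold Rdiv in K4. lra. }
  assert (B * Cmod k ^ 2 <= B * Cmod k) by (apply Rmult_le_compat_l; [lra|simpl; nra]).
  unfold Q in *. nra.
Qed.

(** * Complex-valued functions of a real variable *)

Definition is_derive_RC (f : R -> C) (t : R) (l : C) : Prop :=
  is_derive (fun s => Re (f s)) t (Re l) /\ is_derive (fun s => Im (f s)) t (Im l).

Lemma is_derive_of_quadratic_error (g : R -> R) t l d B : 0 < d -> 0 <= B ->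
  (forall s, Rabs s < d -> Rabs (g (t + s) - g t - s * l) <= B * s ^ 2) -> is_derive g t l.
Proof.
  intros Hd HB H. apply is_derive_Reals. intros eps Heps.
  assert (He : 0 < Rmin d (eps / (B + 1))).
  { apply Rmin_pos; [lra|]. apply Rdiv_lt_0_compat; lra. }
  exists (mkposreal _ He). intros s Hs0 Hs. simpl in Hs.
  replace ((g (t + s) - g t) / s - l) with ((g (t + s) - g t - s * l) / s) by (field; assumption).
  unfold Rdiv. rewrite Rabs_mult, Rabs_inv.
  assert (P : 0 < Rabs s) by now apply Rabs_pos_lt.
  apply Rmult_lt_reg_r with (Rabs s); [exact P|].
  rewrite Rmult_assoc, Rinv_l, Rmult_1_r by lra.
  eapply Rle_lt_trans; [apply H; eapply Rlt_le_trans; [exact Hs|apply Rmin_l]|].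
  assert (Hy' : Rabs s < eps / (B + 1)) by (eapply Rlt_le_trans; [exact Hs|apply Rmin_r]).
  assert (Rabs s * (B + 1) < eps).
  { apply Rmult_lt_reg_r with (/ (B + 1)); [apply Rinv_0_lt_compat; lra|].
    rewrite Rmult_assoc, Rinv_r by lra. unfold Rdiv in Hy'. lra. }
  rewrite <- (pow2_abs s). nra.
Qed.

Lemma quad_derive_affine_line (f : C -> C) (x h : C) (t : R) (l : C) : quad_derive f (x + t * h)%C l ->
  is_derive_RC (fun s : R => f (x + s * h)%C) t (h * l)%C.
Proof.
  intros (d & B & Hd & HB & H).
  set (e := d / (Cmod h + 1)). pose proof (Cmod_ge_0 h) as Hh.
  assert (He : 0 < e) by (apply Rdiv_lt_0_compat; lra).
  assert (HB' : 0 <= B * Cmod h ^ 2) by (apply Rmult_le_pos; [lra|apply pow2_ge_0]).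
  assert (Q : forall s : R, Rabs s < e ->
    Cmod (f (x + (t + s)%R * h) - f (x + t * h) - s * (h * l))%C <= B * Cmod h ^ 2 * s ^ 2).
  { intros s Hs.
    assert (Cmod (s * h)%C < d).
    { rewrite Cmod_mult, Cmod_R. unfold e in Hs. pose proof (Rabs_pos s).
      assert (Rabs s * (Cmod h + 1) < d).
      { apply Rmult_lt_reg_r with (/ (Cmod h + 1)); [apply Rinv_0_lt_compat; lra|].
        rewrite Rmult_assoc, Rinv_r by lra. unfold Rdiv in Hs. lra. }
      nra. }
    specialize (H _ H0). rewrite Cmod_mult, Cmod_R in H.
    replace (x + (t + s)%R * h)%C with (x + t * h + s * h)%C by (rewrite RtoC_plus; ring).
    rewrite Cmult_assoc. eapply Rle_trans; [exact H|]. rewrite <- (pow2_abs s). right; ring. }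
  split; apply is_derive_of_quadratic_error with e (B * Cmod h ^ 2); try assumption; intros s Hs.
  - eapply Rle_trans; [|apply (Q s Hs)]. eapply Rle_trans; [|apply re_le_Cmod].
    right. f_equal.
    generalize (f (x + (t + s)%R * h)%C) (f (x + t * h)%C) (h * l)%C.
    intros u v w. unfold Re, Im. simpl. ring.
  - eapply Rle_trans; [|apply (Q s Hs)]. eapply Rle_trans; [|apply im_le_Cmod].
    right. f_equal.
    generalize (f (x + (t + s)%R * h)%C) (f (x + t * h)%C) (h * l)%C.
    intros u v w. unfold Re, Im. simpl. ring.
Qed.

Lemma quad_derive_line (f : C -> C) (h : C) (t : R) l : quad_derive f (t * h)%C l ->
  is_derive_RC (fun s : R => f (s * h)%C) t (h * l)%C.
Proof.
  intros H. rewrite <- (Cplus_0_l (t * h)%C) in H. apply quad_derive_affine_line in H as [A B].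
  split; [revert A|revert B]; apply is_derive_ext; intros s; now rewrite Cplus_0_l.
Qed.

Lemma is_derive_Rmult (f g : R -> R) t a b : is_derive f t a -> is_derive g t b ->
  is_derive (fun s => f s * g s) t (a * g t + f t * b).
Proof. intros A B. apply is_derive_Reals in A, B. apply is_derive_Reals. now apply derivable_pt_lim_mult. Qed.

Lemma is_derive_Rplus (f g : R -> R) t a b : is_derive f t a -> is_derive g t b ->
  is_derive (fun s => f s + g s) t (a + b).
Proof. intros A B. apply is_derive_Reals in A, B. apply is_derive_Reals. now apply derivable_pt_lim_plus. Qed.

Lemma is_derive_Rcomp (f g : R -> R) t a b : is_derive g t b -> is_derive f (g t) a ->
  is_derive (fun s => f (g s)) t (a * b).
Proof. intros A B. apply is_derive_Reals in A, B. apply is_derive_Reals. now apply derivable_pt_lim_comp. Qed.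

Lemma is_derive_RC_const c t : is_derive_RC (fun _ => c) t 0%C.
Proof. split; apply (is_derive_const (K := R_AbsRing) (V := R_NormedModule)). Qed.

Lemma is_derive_RC_mult f g t lf lg : is_derive_RC f t lf -> is_derive_RC g t lg ->
  is_derive_RC (fun s => f s * g s)%C t (lf * g t + f t * lg)%C.
Proof.
  intros [A B] [A' B']. split.
  - apply is_derive_ext with (fun s => Re (f s) * Re (g s) + - 1 * (Im (f s) * Im (g s))).
    { intros s. unfold Re, Im. simpl. ring. }
    replace (Re (lf * g t + f t * lg)%C) with
      ((Re lf * Re (g t) + Re (f t) * Re lg) + - 1 * (Im lf * Im (g t) + Im (f t) * Im lg))
      by (unfold Re, Im; simpl; ring).
    apply is_derive_Rplus; [|apply is_derive_scal]; now apply is_derive_Rmult.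
  - apply is_derive_ext with (fun s => Re (f s) * Im (g s) + Im (f s) * Re (g s)).
    { intros s. unfold Re, Im. simpl. ring. }
    replace (Im (lf * g t + f t * lg)%C) with
      ((Re lf * Im (g t) + Re (f t) * Im lg) + (Im lf * Re (g t) + Im (f t) * Re lg))
      by (unfold Re, Im; simpl; ring).
    apply is_derive_Rplus; now apply is_derive_Rmult.
Qed.

Lemma is_derive_RC_scal c f t l : is_derive_RC f t l -> is_derive_RC (fun s => c * f s)%C t (c * l)%C.
Proof.
  intros H. replace (c * l)%C with (0 * f t + c * l)%C by ring.
  apply (is_derive_RC_mult (fun _ => c)); [apply is_derive_RC_const|exact H].
Qed.

Lemma is_derive_RC_0_const (f : R -> C) : (forall t, 0 <= t <= 1 -> is_derive_RC f t 0%C) -> f 1 = f 0.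
Proof.
  intros H. 
  assert (A : Re (f 0) = Re (f 1)).
  { apply (eq_is_derive (fun s => Re (f s)) 0 1); [|lra]. intros t Ht. apply H. exact Ht. }
  assert (B : Im (f 0) = Im (f 1)).
  { apply (eq_is_derive (fun s => Im (f s)) 0 1); [|lra]. intros t Ht. apply H. exact Ht. }
  destruct (f 0), (f 1). simpl in *. congruence.
Qed.

Lemma is_derive_RC_Cexp f t l : is_derive_RC f t l -> is_derive_RC (fun s => Cexp (f s)) t (l * Cexp (f t))%C.
Proof.
  intros [A B].
  assert (E : is_derive (fun s => exp (Re (f s))) t (exp (Re (f t)) * Re l)).
  { apply is_derive_Rcomp; [exact A|]. apply is_derive_Reals, derivable_pt_lim_exp. }
  assert (S : is_derive (fun s => sin (Im (f s))) t (cos (Im (f t)) * Im l)).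
  { apply is_derive_Rcomp; [exact B|]. apply is_derive_Reals, derivable_pt_lim_sin. }
  assert (Co : is_derive (fun s => cos (Im (f s))) t (- sin (Im (f t)) * Im l)).
  { apply is_derive_Rcomp; [exact B|]. apply is_derive_Reals, derivable_pt_lim_cos. }
  split.
  - replace (Re (l * Cexp (f t))%C) with
     (exp (Re (f t)) * Re l * cos (Im (f t)) + exp (Re (f t)) * (- sin (Im (f t)) * Im l))
     by (unfold Cexp, Re, Im; simpl; ring).
    apply (is_derive_Rmult (fun s => exp (Re (f s))) (fun s => cos (Im (f s)))); assumption.
  - replace (Im (l * Cexp (f t))%C) with
     (exp (Re (f t)) * Re l * sin (Im (f t)) + exp (Re (f t)) * (cos (Im (f t)) * Im l))
     by (unfold Cexp, Re, Im; simpl; ring).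
    apply (is_derive_Rmult (fun s => exp (Re (f s))) (fun s => sin (Im (f s)))); assumption.
Qed.

(** * A bound for an Euler differential equation *)

Definition Cdot (u v : C) : R := Re u * Re v + Im u * Im v.

Lemma Cdot_self u : Cdot u u = Cmod u ^ 2.
Proof. rewrite Cmod2_alt. unfold Cdot. ring. Qed.

Lemma Cdot_le u v : Cdot u v <= Cmod u * Cmod v.
Proof.
  pose proof (Cmod2_alt u) as A. pose proof (Cmod2_alt v) as B.
  pose proof (Cmod_ge_0 u). pose proof (Cmod_ge_0 v).
  apply Rsqr_incr_0_var; [|now apply Rmult_le_pos]. unfold Rsqr, Cdot.
  replace (Cmod u * Cmod v * (Cmod u * Cmod v)) with (Cmod u ^ 2 * Cmod v ^ 2) by ring.
  rewrite A, B. pose proof (pow2_ge_0 (Re u * Im v - Im u * Re v)). nra.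
Qed.

Lemma is_derive_RC_Cdot f g t lf lg : is_derive_RC f t lf -> is_derive_RC g t lg ->
  is_derive (fun s => Cdot (f s) (g s)) t (Cdot lf (g t) + Cdot (f t) lg).
Proof.
  intros [A B] [A' B'].
  replace (Cdot lf (g t) + Cdot (f t) lg) with
    ((Re lf * Re (g t) + Re (f t) * Re lg) + (Im lf * Im (g t) + Im (f t) * Im lg)) by (unfold Cdot; ring).
  apply is_derive_Rplus; apply is_derive_Rmult; assumption.
Qed.

(** The mean value theorem for complex values: apply the real one to the
    component of [U] in the direction of [U T]. *)
Lemma Cmod_le_of_derive_bound (U W : R -> C) N T : 0 <= T ->
  (forall t, 0 <= t <= T -> is_derive_RC U t (W t)) ->
  (forall t, 0 <= t <= T -> Cmod (W t) <= N) -> U 0 = 0%C -> Cmod (U T) <= N * T.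
Proof.
  intros HT HU HW H0.
  destruct (MVT_gen (fun s => Cdot (U T) (U s)) 0 T (fun s => Cdot (U T) (W s))) as (c & Hc & E).
  - intros x Hx. rewrite Rmin_left, Rmax_right in Hx by lra.
    replace (Cdot (U T) (W x)) with (Cdot 0%C (U x) + Cdot (U T) (W x)) by (unfold Cdot; simpl; ring).
    apply (is_derive_RC_Cdot (fun _ => U T) U); [apply is_derive_RC_const|apply HU; lra].
  - intros x Hx. rewrite Rmin_left, Rmax_right in Hx by lra.
    apply continuity_pt_filterlim.
    eapply (ex_derive_continuous (fun s => Cdot (U T) (U s))).
    eexists. apply (is_derive_RC_Cdot (fun _ => U T) U); [apply is_derive_RC_const|apply HU; lra].
  - rewrite Rmin_left, Rmax_right in Hc by lra.
    rewrite Cdot_self, H0 in E. unfold Cdot at 1 in E. simpl Re in E; simpl Im in E.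
    pose proof (Cdot_le (U T) (W c)) as L. pose proof (HW c Hc) as B.
    pose proof (Cmod_ge_0 (U T)) as P. pose proof (Cmod_ge_0 (W c)).
    assert (Q : Cmod (U T) ^ 2 <= Cmod (U T) * (N * T)).
    { assert (Cdot (U T) (W c) <= Cmod (U T) * N) by nra. nra. }
    destruct (Rle_lt_or_eq_dec _ _ P) as [P'|P'].
    + apply Rmult_le_reg_l with (Cmod (U T)); [exact P'|]. lra.
    + rewrite <- P'. apply Rmult_le_pos; lra.
Qed.

(** Only points on the left are compared, so that the maximum may be at the end
    point of an interval. *)
Lemma derive_nonneg_at_left_max (S : R -> R) r l : 0 < r -> is_derive S r l ->
  (forall t, 0 <= t <= r -> S t <= S r) -> 0 <= l.
Proof.
  intros Hr D Hmax. apply Rnot_lt_le. intros Hl.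
  apply is_derive_Reals in D. destruct (D (- l)) as [d Hd]; [lra|].
  pose proof (cond_pos d).
  set (h := - (Rmin d r / 2)).
  assert (0 < Rmin d r) by (apply Rmin_pos; lra).
  assert (Rmin d r <= d) by apply Rmin_l. assert (Rmin d r <= r) by apply Rmin_r.
  assert (Hh : h < 0) by (unfold h; lra).
  specialize (Hd h). rewrite (Rabs_left h) in Hd by lra.
  assert (A : Rabs ((S (r + h) - S r) / h - l) < - l) by (apply Hd; unfold h; lra).
  apply Rabs_def2 in A.
  assert (B : S (r + h) <= S r) by (apply Hmax; unfold h; lra).
  assert (0 <= (S (r + h) - S r) / h).
  { unfold Rdiv. pose proof (Rinv_lt_0_compat h Hh). nra. }
  lra.
Qed.

Lemma le_at_0_of_right (g : R -> R) b : continuity_pt g 0 ->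
  (forall t, 0 < t <= 1 -> g t <= b) -> g 0 <= b.
Proof.
  intros C H. apply Rnot_lt_le. intros Hb.
  destruct (C (g 0 - b)) as (d & Hd & Hc); [lra|].
  set (t := Rmin d 1 / 2).
  assert (0 < Rmin d 1) by (apply Rmin_pos; lra).
  assert (Rmin d 1 <= d) by apply Rmin_l. assert (Rmin d 1 <= 1) by apply Rmin_r.
  assert (A : R_dist (g t) (g 0) < g 0 - b).
  { apply Hc. split; [split; [exact I|unfold t; lra]|].
    simpl. unfold R_dist. rewrite Rabs_pos_eq; unfold t; lra. }
  unfold R_dist in A. apply Rabs_def2 in A. specialize (H t). unfold t in *. lra.
Qed.

(** At a point [r] where [Cmod W] reaches its maximum [N], the derivative of
    [(Cmod W) ^ 2] is nonnegative (or [r = 0]), so that the term with [V] only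
    helps in the scalar product of the equation with [W r].  The rest of the
    equation gives [g1 N <= E + N], since [Cmod (U t) <= N t]. *)
Lemma euler_ode_bound (g1 g2 E : R) (U W V F : R -> C) :
  1 < g1 -> 0 <= g2 -> 0 <= E ->
  (forall t, 0 <= t <= 1 -> is_derive_RC U t (W t)) ->
  (forall t, 0 <= t <= 1 -> is_derive_RC W t (V t)) ->
  (exists l, is_derive_RC V 0 l) ->
  U 0 = 0%C ->
  (forall t, 0 <= t <= 1 -> (U t + g1 * t * W t + g2 * t ^ 2 * V t = F t)%C) ->
  (forall t, 0 <= t <= 1 -> Cmod (F t) <= E * t) ->
  Cmod (U 1) <= E / (g1 - 1).
Proof.
  intros Hg1 Hg2 HE HU HW [lV HV] U0 ODE HF.
  destruct (continuity_ab_maj (fun t => Cdot (W t) (W t)) 0 1) as (r & Hmax & Hr); [lra| |].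
  { intros c Hc. apply continuity_pt_filterlim.
    eapply (ex_derive_continuous (fun s => Cdot (W s) (W s))).
    eexists. apply is_derive_RC_Cdot; apply HW; lra. }
  set (N := Cmod (W r)).
  assert (HN : 0 <= N) by apply Cmod_ge_0.
  assert (WN : forall t, 0 <= t <= 1 -> Cmod (W t) <= N).
  { intros t Ht. specialize (Hmax t Ht). rewrite !Cdot_self in Hmax. fold N in Hmax.
    pose proof (Cmod_ge_0 (W t)). apply Rsqr_incr_0_var; [|exact HN]. unfold Rsqr. simpl in Hmax. lra. }
  assert (UN : forall t, 0 <= t <= 1 -> Cmod (U t) <= N * t).
  { intros t Ht. apply Cmod_le_of_derive_bound with W; try tauto.
    - intros s Hs; apply HU; lra.
    - intros s Hs; apply WN; lra. }
  (* The equation divided by [t] reads [D t = (F t - U t) / t]; it is used at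
     [t = 0] too, by continuity, as the maximum may be reached there. *)
  set (D := fun t : R => (g1 * W t + g2 * t * V t)%C).
  assert (Dpos : forall t, 0 < t <= 1 -> Cmod (D t) <= E + N).
  { intros t Ht. apply Rmult_le_reg_l with t; [lra|].
    replace (t * Cmod (D t)) with (Cmod (F t - U t)%C).
    - eapply Rle_trans; [apply Cmod_triangle|]. rewrite Cmod_opp.
      assert (Ht' : 0 <= t <= 1) by lra.
      specialize (HF t Ht'). specialize (UN t Ht'). lra.
    - rewrite <- (ODE t) by lra. rewrite <- (Rabs_pos_eq t) at 7 by lra. rewrite <- Cmod_R, <- Cmod_mult.
      f_equal. unfold D. ring. }
  assert (D0 : Cmod (D 0) <= E + N).
  { apply Rsqr_incr_0_var; [|lra]. rewrite !Rsqr_pow2, <- Cdot_self.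
    apply (le_at_0_of_right (fun t => Cdot (D t) (D t))).
    - apply continuity_pt_filterlim.
      eapply (ex_derive_continuous (fun s => Cdot (D s) (D s))).
      destruct (HW 0) as [W1 W2]; [lra|]. destruct HV as [V1 V2].
      assert (ED : exists l, is_derive_RC D 0 l).
      { eexists (_, _). split.
        - apply is_derive_ext with (fun t => g1 * Re (W t) + g2 * (t * Re (V t))).
          + intros t. unfold D, Re, Im. simpl. ring.
          + simpl. apply is_derive_Rplus.
            * apply is_derive_scal. exact W1.
            * apply is_derive_scal. apply is_derive_Rmult; [|exact V1]. apply (is_derive_id (K := R_AbsRing)).
        - apply is_derive_ext with (fun t => g1 * Im (W t) + g2 * (t * Im (V t))).
          + intros t. unfold D, Re, Im. simpl. ring.
          + simpl. apply is_derive_Rplus.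
            * apply is_derive_scal. exact W2.
            * apply is_derive_scal. apply is_derive_Rmult; [|exact V2]. apply (is_derive_id (K := R_AbsRing)). }
      destruct ED as [lD ED]. eexists. apply is_derive_RC_Cdot; exact ED.
    - intros t Ht. rewrite Cdot_self. pose proof (Cmod_ge_0 (D t)). specialize (Dpos t Ht).
      apply pow_incr. lra. }
  assert (Dr : Cmod (D r) <= E + N).
  { destruct (Req_dec r 0) as [->|Hr0]; [exact D0|apply Dpos; lra]. }
  assert (WV : 0 <= r * Cdot (W r) (V r)).
  { destruct (Req_dec r 0) as [->|Hr0]; [lra|].
    assert (0 <= Cdot (V r) (W r) + Cdot (W r) (V r)).
    { apply (derive_nonneg_at_left_max (fun t => Cdot (W t) (W t)) r); [lra| |].
      - apply is_derive_RC_Cdot; now apply HW.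
      - intros t Ht. apply Hmax. lra. }
    unfold Cdot in *. apply Rmult_le_pos; lra. }
  assert (Key : g1 * N ^ 2 <= N * (E + N)).
  { apply Rle_trans with (Cdot (W r) (D r)).
    - replace (Cdot (W r) (D r)) with (g1 * Cdot (W r) (W r) + g2 * (r * Cdot (W r) (V r))).
      + rewrite Cdot_self. fold N. pose proof (Rmult_le_pos _ _ Hg2 WV). lra.
      + unfold D, Cdot, Re, Im. simpl. ring.
    - eapply Rle_trans; [apply Cdot_le|]. fold N. now apply Rmult_le_compat_l. }
  assert (NB : N <= E / (g1 - 1)).
  { apply Rmult_le_reg_r with (g1 - 1); [lra|]. unfold Rdiv.
    rewrite Rmult_assoc, Rinv_l, Rmult_1_r by lra.
    destruct (Rle_lt_or_eq_dec _ _ HN) as [P|P].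
    - apply Rmult_le_reg_l with N; [exact P|]. nra.
    - rewrite <- P. lra. }
  specialize (UN 1). lra.
Qed.

(** * Division and integration of power series *)

Fixpoint Cpartial_sum (u : nat -> C) (n : nat) : C :=
  match n with O => 0%C | S m => (Cpartial_sum u m + u m)%C end.

Lemma sum_n_Cpartial_sum u n : sum_n (G := C_AbelianMonoid) u n = Cpartial_sum u (S n).
Proof.
  induction n as [|n IH].
  - rewrite sum_O. simpl. now rewrite Cplus_0_l.
  - rewrite sum_Sn, IH. reflexivity.
Qed.

Lemma Cpartial_sum_ext u v n : (forall k, (k < n)%nat -> u k = v k) -> Cpartial_sum u n = Cpartial_sum v n.
Proof.
  induction n as [|n IH]; intros H; [reflexivity|]. simpl. rewrite IH, H by (intros; try apply H; lia).
  reflexivity.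
Qed.

Lemma Cpartial_sum_scal_r u c n : Cpartial_sum (fun k => u k * c)%C n = (Cpartial_sum u n * c)%C.
Proof. induction n as [|n IH]; simpl; [ring|]. rewrite IH. ring. Qed.

(** Long division is a course-of-values recursion: [div_prefix a b n] holds the
    first [n] coefficients of the quotient [b / a]. *)
Fixpoint div_prefix (a b : nat -> C) (n : nat) : nat -> C :=
  match n with
  | O => fun _ => 0%C
  | S m => fun k =>
      if Nat.eqb k m
      then ((b m - Cpartial_sum (fun j => div_prefix a b m j * a (m - j)%nat) m) / a O)%C
      else div_prefix a b m k
  end.

Definition CPS_div (b a : nat -> C) (n : nat) : C := div_prefix a b (S n) n.

Lemma div_prefix_stable (a b : nat -> C) n k : (k < n)%nat -> div_prefix a b n k = CPS_div b a k.
Proof.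
  induction n as [|n IH]; intros Hk; [lia|].
  destruct (Nat.eq_dec k n) as [->|Hn]; [reflexivity|].
  simpl. rewrite (proj2 (Nat.eqb_neq k n) Hn). apply IH. lia.
Qed.

Lemma CPS_div_rec (b a : nat -> C) n :
  CPS_div b a n = ((b n - Cpartial_sum (fun j => CPS_div b a j * a (n - j)%nat) n) / a O)%C.
Proof.
  unfold CPS_div at 1. simpl. rewrite Nat.eqb_refl. do 2 f_equal.
  apply Cpartial_sum_ext. intros k Hk. now rewrite div_prefix_stable.
Qed.

Lemma Cconv_CPS_div (b a : nat -> C) n : a 0%nat <> 0%C -> Cconv (CPS_div b a) a n = b n.
Proof.
  intros Ha. unfold Cconv. rewrite sum_n_Cpartial_sum. simpl. rewrite Nat.sub_diag, (CPS_div_rec b a n).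
  field. exact Ha.
Qed.

(** With [A = M / Cmod (a 0)], the normalised coefficients
    [E_n = Cmod (d_n) / K ^ n] of the quotient satisfy
    [E_n <= A + A * (E_0 + ... + E_(n-1))].  Equality holds for
    [A * (1 + A) ^ n], which is therefore an upper bound. *)
Lemma CPS_div_geom (b a : nat -> C) M K : geom_bounded a M K -> geom_bounded b M K -> a 0%nat <> 0%C ->
  exists M' K', geom_bounded (CPS_div b a) M' K' /\ K <= K'.
Proof.
  intros (HM & HK & Ha) (_ & _ & Hb) Ha0.
  set (m := Cmod (a 0%nat)). assert (Hm : 0 < m) by now apply Cmod_gt_0.
  set (A := M / m). assert (HA : 0 <= A) by (apply Rmult_le_pos; [lra|left; now apply Rinv_0_lt_compat]).
  assert (EM : M = A * m) by (unfold A; field; lra).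
  exists A, (K * (1 + A)).
  assert (HQ : forall n, 0 <= K ^ n) by (intros; apply pow_le; lra).
  assert (HP : forall n, 0 <= (1 + A) ^ n) by (intros; apply pow_le; lra).
  split; [|nra]. repeat split; [exact HA|nra|].
  intros n. rewrite Rpow_mult_distr.
  induction n as [n IH] using (well_founded_induction Wf_nat.lt_wf).
  assert (S : forall i, (i <= n)%nat ->
    Cmod (Cpartial_sum (fun j => CPS_div b a j * a (n - j)%nat)%C i) <= M * K ^ n * ((1 + A) ^ i - 1)).
  { induction i as [|i IHi]; intros Hi.
    - simpl. rewrite Cmod_0. lra.
    - simpl Cpartial_sum. eapply Rle_trans; [apply Cmod_triangle|]. rewrite Cmod_mult.
      assert (Hi' : (i <= n)%nat) by lia. specialize (IHi Hi').
      assert (T : Cmod (CPS_div b a i) * Cmod (a (n - i)%nat) <= A * (K ^ i * (1 + A) ^ i) * (M * K ^ (n - i))).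
      { apply Rmult_le_compat; try apply Cmod_ge_0; [apply IH; lia|apply Ha]. }
      replace (K ^ n) with (K ^ i * K ^ (n - i)) in * by (rewrite <- pow_add; f_equal; lia).
      simpl ((1 + A) ^ Datatypes.S i). lra. }
  specialize (S n (le_n n)).
  rewrite CPS_div_rec, Cmod_div by exact Ha0. fold m.
  apply Rmult_le_reg_r with m; [exact Hm|]. unfold Rdiv. rewrite Rmult_assoc, Rinv_l, Rmult_1_r by lra.
  eapply Rle_trans; [apply Cmod_triangle|]. rewrite Cmod_opp. specialize (Hb n).
  replace (A * (K ^ n * (1 + A) ^ n) * m) with (M * K ^ n * (1 + A) ^ n) by (rewrite EM; ring). lra.
Qed.

Lemma CPS_mult a b M K M' K' h : geom_bounded a M K -> geom_bounded b M' K' ->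
  K * Cmod h < 1 -> K' * Cmod h < 1 -> CPSeries (Cconv a b) h = (CPSeries a h * CPSeries b h)%C.
Proof.
  intros Ha Hb H H'. unfold CPSeries.
  rewrite <- CSum_mult by (eapply CPS_summable; eassumption).
  apply CSum_ext. intros n. unfold Cconv. rewrite !sum_n_Cpartial_sum, <- Cpartial_sum_scal_r.
  apply Cpartial_sum_ext. intros k Hk.
  replace (h ^ n)%C with (h ^ k * h ^ (n - k))%C; [ring|].
  rewrite <- Cpow_add_r. f_equal. lia.
Qed.

Lemma CPS_0 a : CPSeries a 0 = a 0%nat.
Proof.
  unfold CPSeries. assert (H : forall n, Cmod (a n * 0 ^ n)%C <= Cmod (a 0%nat) * 0 ^ n).
  { intros [|n]; rewrite Cmod_mult, Cmod_pow, Cmod_0; simpl; lra. }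
  rewrite CSum_incr_1.
  - assert (E : CSum (fun n => a (S n) * 0 ^ S n)%C = 0%C).
    { rewrite (CSum_ext _ (fun n => 0 * (0 * 0 ^ n))%C).
      - rewrite CSum_scal; [ring|]. eapply abs_summable_le with (v := fun n => 1 * 0 ^ n).
        + intros n. rewrite Cmod_mult, Cmod_0. pose proof (pow_le 0 n (Rle_refl 0)). lra.
        + apply ex_series_geom_scal. lra.
      - intros n. simpl. ring. }
    rewrite E. simpl. ring.
  - eapply abs_summable_le; [exact H|]. apply ex_series_geom_scal. lra.
Qed.

Definition CPS_primitive (c : C) (d : nat -> C) (n : nat) : C :=
  match n with O => c | S m => (d m / INR (S m))%C end.

Lemma CPS_derive_primitive c d n : CPS_derive (CPS_primitive c d) n = d n.
Proof.
  unfold CPS_derive, CPS_primitive. field.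
  intros H. apply RtoC_inj in H. apply (not_0_INR (S n)); [discriminate|exact H].
Qed.

Lemma CPS_primitive_geom c d M K : geom_bounded d M K ->
  geom_bounded (CPS_primitive c d) (Cmod c + M / K) K.
Proof.
  intros (HM & HK & Hd). pose proof (Cmod_ge_0 c) as Hc.
  assert (HMK : 0 <= M / K) by (apply Rmult_le_pos; [lra|left; now apply Rinv_0_lt_compat]).
  repeat split; [lra|lra|]. intros [|n].
  - simpl. lra.
  - unfold CPS_primitive. assert (HS : 1 <= INR (S n)) by (rewrite S_INR; pose proof (pos_INR n); lra).
    rewrite Cmod_div by (intros H; apply RtoC_inj in H; lra).
    rewrite Cmod_R, Rabs_pos_eq by lra.
    assert (0 <= K ^ S n) by (apply pow_le; lra).
    apply Rle_trans with (M * K ^ n).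
    + apply Rle_trans with (Cmod (d n)); [|apply Hd].
      apply Rmult_le_reg_r with (INR (S n)); [lra|]. unfold Rdiv.
      rewrite Rmult_assoc, Rinv_l by lra. pose proof (Cmod_ge_0 (d n)). nra.
    + replace (M * K ^ n) with (M / K * K ^ S n) by (simpl; field; lra).
      apply Rmult_le_compat_r; [assumption|lra].
Qed.

(** * The complex exponential and the principal logarithm *)

Lemma Cexp_plus u v : Cexp (u + v)%C = (Cexp u * Cexp v)%C.
Proof.
  unfold Cexp, Cmult, Re, Im. simpl. rewrite exp_plus, cos_plus, sin_plus.
  f_equal; ring.
Qed.

Lemma Cexp_0 : Cexp 0%C = 1%C.
Proof. unfold Cexp, Re, Im. simpl. rewrite exp_0, cos_0, sin_0. unfold RtoC. f_equal; ring. Qed.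

Lemma Cexp_opp_l u : (Cexp (- u) * Cexp u)%C = 1%C.
Proof. rewrite <- Cexp_plus, <- Cexp_0. f_equal. ring. Qed.

Lemma Cmod_Cexp u : Cmod (Cexp u) = exp (Re u).
Proof.
  unfold Cmod, Cexp. simpl fst; simpl snd.
  replace ((exp (Re u) * cos (Im u)) ^ 2 + (exp (Re u) * sin (Im u)) ^ 2) with (Rsqr (exp (Re u))).
  - apply sqrt_Rsqr. left. apply exp_pos.
  - generalize (sin2_cos2 (Im u)). unfold Rsqr. intros H.
    transitivity (exp (Re u) * exp (Re u) * (sin (Im u) * sin (Im u) + cos (Im u) * cos (Im u))); [rewrite H|]; ring.
Qed.

Definition Clog (z : C) : C := (ln (Cmod z), atan (Im z / Re z)).

Lemma Cexp_Clog z : 0 < Re z -> Cexp (Clog z) = z.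
Proof.
  intros Hz. assert (Hm : 0 < Cmod z).
  { eapply Rlt_le_trans; [exact Hz|]. eapply Rle_trans; [apply Rle_abs|apply re_le_Cmod]. }
  unfold Cexp, Clog. simpl Re; simpl Im. rewrite exp_ln, cos_atan, sin_atan by exact Hm.
  assert (E : Cmod z = Re z * sqrt (1 + (Im z / Re z)²)).
  { rewrite <- (sqrt_Rsqr (Re z)) at 1 by lra. rewrite <- sqrt_mult.
    - unfold Cmod. f_equal. change (fst z) with (Re z). change (snd z) with (Im z).
      unfold Rsqr. field. lra.
    - apply Rle_0_sqr.
    - generalize (Rle_0_sqr (Im z / Re z)). lra. }
  assert (Hq : 0 < sqrt (1 + (Im z / Re z)²)).
  { apply sqrt_lt_R0. generalize (Rle_0_sqr (Im z / Re z)). lra. }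
  rewrite E. destruct z as [x y]. simpl in *. f_equal; field; lra.
Qed.

Lemma Clog_Cexp w : Rabs (Im w) < PI / 2 -> Clog (Cexp w) = w.
Proof.
  intros H. apply Rabs_def2 in H. unfold Clog. rewrite Cmod_Cexp, ln_exp.
  unfold Cexp. simpl Re; simpl Im.
  replace (exp (Re w) * sin (Im w) / (exp (Re w) * cos (Im w))) with (tan (Im w)).
  - rewrite atan_tan by lra. now destruct w.
  - unfold tan. field. split; [|apply Rgt_not_eq, exp_pos]. apply Rgt_not_eq, cos_gt_0; lra.
Qed.

Lemma Rabs_Im_Clog z : Rabs (Im (Clog z)) < PI / 2.
Proof.
  unfold Clog. simpl. pose proof (atan_bound (Im z / Re z)). apply Rabs_def1; lra.
Qed.

Lemma ln_le_sub_1 x : 0 < x -> ln x <= x - 1.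
Proof.
  intros Hx. pose proof (exp_ineq1_le (ln x)) as H. rewrite exp_ln in H by exact Hx. lra.
Qed.

Lemma Rabs_atan_le x : Rabs (atan x) <= Rabs x.
Proof.
  destruct (MVT_gen atan 0 x (fun y => / (1 + y ^ 2))) as (c & _ & E).
  - intros y _. apply is_derive_Reals, derivable_pt_lim_atan.
  - intros y _. apply derivable_continuous_pt, derivable_pt_atan.
  - rewrite atan_0, !Rminus_0_r in E. rewrite E, Rabs_mult.
    assert (0 < / (1 + c ^ 2) <= 1).
    { pose proof (pow2_ge_0 c). split; [apply Rinv_0_lt_compat; lra|].
      rewrite <- Rinv_1. apply Rinv_le_contravar; lra. }
    rewrite (Rabs_pos_eq (/ _)) by lra. pose proof (Rabs_pos x). nra.
Qed.

(** Both components of [Clog (1 + u)] are at most [r / (1 - r)] for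
    [r = Cmod u]: the modulus and the real part of [1 + u] are at least
    [1 - r]. *)
Lemma Cmod_Clog_le u : Cmod u < 1 -> Cmod (Clog (1 + u)%C) <= 2 * Cmod u / (1 - Cmod u).
Proof.
  intros Hu. set (r := Cmod u) in *. assert (Hr : 0 <= r) by apply Cmod_ge_0.
  assert (I : 0 < / (1 - r)) by (apply Rinv_0_lt_compat; lra).
  assert (I' : (1 - r) * / (1 - r) = 1) by (apply Rinv_r; lra).
  assert (U : Cmod (1 + u)%C <= 1 + r).
  { eapply Rle_trans; [apply Cmod_triangle|]. rewrite Cmod_1. apply Rle_refl. }
  assert (L : 1 - r <= Re (1 + u)%C).
  { change (Re (1 + u)%C) with (1 + Re u).
    pose proof (re_le_Cmod u) as H. pose proof (Rle_abs (- Re u)) as H'.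
    rewrite Rabs_Ropp in H'. fold r in H. lra. }
  assert (L' : 1 - r <= Cmod (1 + u)%C).
  { eapply Rle_trans; [exact L|]. eapply Rle_trans; [apply Rle_abs|apply re_le_Cmod]. }
  assert (A : Rabs (ln (Cmod (1 + u)%C)) <= r / (1 - r)).
  { apply Rabs_le. split.
    - apply Rle_trans with (ln (1 - r)); [|apply ln_le; lra].
      pose proof (ln_le_sub_1 (/ (1 - r)) I) as H. rewrite ln_Rinv in H by lra. unfold Rdiv. nra.
    - apply Rle_trans with r.
      + eapply Rle_trans; [apply ln_le_sub_1; lra|lra].
      + unfold Rdiv. assert (1 <= / (1 - r)) by nra. nra. }
  assert (B : Rabs (atan (Im (1 + u)%C / Re (1 + u)%C)) <= r / (1 - r)).
  { eapply Rle_trans; [apply Rabs_atan_le|]. unfold Rdiv. rewrite Rabs_mult, Rabs_inv.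
    apply Rmult_le_compat.
    - apply Rabs_pos.
    - left. apply Rinv_0_lt_compat. apply Rabs_pos_lt. lra.
    - replace (Im (1 + u)%C) with (Im u) by (unfold Im; simpl; ring). apply im_le_Cmod.
    - apply Rinv_le_contravar; [lra|]. eapply Rle_trans; [exact L|apply Rle_abs]. }
  eapply Rle_trans; [apply Cmod_le_Re_Im|]. unfold Clog. simpl Re at 1; simpl Im at 1.
  change (Rabs (ln (Cmod (1 + u)%C)) + Rabs (atan (Im (1 + u)%C / Re (1 + u)%C)) <= 2 * r / (1 - r)).
  unfold Rdiv in *. lra.
Qed.

(** * Logarithms of analytic functions *)

(** The condition on coefficients says that [W' a = a'] for the sums, so that
    [a exp (- W)] has derivative 0 on the segment from 0 to [h]. *)
Lemma CPS_exp_log a W M K h :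
  geom_bounded a M K -> geom_bounded W M K -> 32 * K * Cmod h < 1 ->
  (forall n, Cconv (CPS_derive W) a n = CPS_derive a n) ->
  Cexp (W 0%nat) = a 0%nat -> CPSeries a h = Cexp (CPSeries W h).
Proof.
  intros Ha HW Hh Hd H0. pose proof Ha as (HM & HK & _).
  pose proof (Cmod_ge_0 h) as Hh0.
  set (G := fun t : R => (CPSeries a (t * h) * Cexp (- (1) * CPSeries W (t * h)))%C).
  assert (E : G 1 = G 0).
  { apply is_derive_RC_0_const. intros t Ht.
    assert (Hth : Cmod (t * h)%C <= Cmod h).
    { rewrite Cmod_mult, Cmod_R, Rabs_pos_eq by lra. nra. }
    assert (Hk : 16 * K * Cmod (t * h)%C < 1) by nra.
    pose proof (CPS_quad_derive a M K _ Ha Hk) as Da.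
    pose proof (CPS_quad_derive W M K _ HW Hk) as DW.
    assert (EP : CPSeries (CPS_derive a) (t * h)%C = (CPSeries (CPS_derive W) (t * h) * CPSeries a (t * h))%C).
    { rewrite <- (CPS_mult (CPS_derive W) a (2 * M * K) (2 * K) M K); [|now apply geom_bounded_CPS_derive|exact Ha|nra|nra].
      apply CSum_ext. intros n. now rewrite Hd. }
    rewrite EP in Da.
    apply quad_derive_line in Da, DW.
    pose proof (is_derive_RC_mult _ _ _ _ _ Da
      (is_derive_RC_Cexp _ _ _ (is_derive_RC_scal (- (1))%C _ _ _ DW))) as D.
    replace (RtoC 0) with
      (h * (CPSeries (CPS_derive W) (t * h) * CPSeries a (t * h))
         * Cexp (- (1) * CPSeries W (t * h)) +
       CPSeries a (t * h) * (- (1) * (h * CPSeries (CPS_derive W) (t * h))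
         * Cexp (- (1) * CPSeries W (t * h))))%C by ring.
    exact D. }
  unfold G in E. rewrite !Cmult_1_l, !Cmult_0_l, !CPS_0, <- H0 in E.
  replace (- (1) * CPSeries W h)%C with (- CPSeries W h)%C in E by ring.
  replace (- (1) * W 0%nat)%C with (- W 0%nat)%C in E by ring.
  rewrite (Cmult_comm (Cexp (W 0%nat))), Cexp_opp_l in E.
  transitivity (CPSeries a h * (Cexp (- CPSeries W h) * Cexp (CPSeries W h)))%C.
  - rewrite Cexp_opp_l. ring.
  - rewrite Cmult_assoc, E. ring.
Qed.

(** The formal logarithm of the series of [f], that is the primitive of the
    formal quotient [f' / f], has [f] as exponential; it is the principal
    logarithm near [x] because its imaginary part remains close to
    [Im (Clog (f x))]. *)
Lemma analytic_at_Clog f x : analytic_at f x -> 0 < Re (f x) -> analytic_at (fun y => Clog (f y)) x.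
Proof.
  intros Hf Hre. destruct (analytic_at_CPSeries f x Hf) as (a & M & K & d & Ha & Hd & HKd & Hfa).
  assert (Ea : f x = a 0%nat).
  { rewrite <- (Cplus_0_r x), Hfa, CPS_0 by now rewrite Cmod_0. reflexivity. }
  assert (Ha0 : a 0%nat <> 0%C).
  { intros E. rewrite Ea, E in Hre. simpl in Hre. lra. }
  pose proof (geom_bounded_CPS_derive a M K Ha) as Hs. pose proof Ha as (HM & HK & _).
  assert (HMK : 0 <= 2 * M * K) by (apply Rmult_le_pos; lra).
  destruct (CPS_div_geom (CPS_derive a) a (M + 2 * M * K) (2 * K)) as (M1 & K1 & Hd1 & HK1).
  { apply (geom_bounded_weaken _ _ _ _ _ Ha); lra. }
  { apply (geom_bounded_weaken _ _ _ _ _ Hs); lra. }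
  { exact Ha0. }
  set (W := CPS_primitive (Clog (a 0%nat)) (CPS_div (CPS_derive a) a)).
  pose proof (CPS_primitive_geom (Clog (a 0%nat)) _ _ _ Hd1) as HW. fold W in HW.
  set (M2 := Cmod (Clog (a 0%nat)) + M1 / K1) in *.
  assert (HM2 : 0 <= M2) by apply HW.
  assert (Ha' : geom_bounded a (M + M2) K1) by (apply (geom_bounded_weaken _ _ _ _ _ Ha); lra).
  assert (HW' : geom_bounded W (M + M2) K1) by (apply (geom_bounded_weaken _ _ _ _ _ HW); lra).
  set (eps := PI / 2 - Rabs (Im (Clog (a 0%nat)))).
  assert (Heps : 0 < eps) by (unfold eps; pose proof (Rabs_Im_Clog (a 0%nat)); lra).
  assert (DW : quad_derive (CPSeries W) 0 (CPSeries (CPS_derive W) 0)).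
  { apply (CPS_quad_derive W _ _ 0 HW'). rewrite Cmod_0. lra. }
  destruct (quad_derive_close _ _ _ eps DW Heps) as (d1 & Hd1' & Hclose).
  set (e := Rmin d (Rmin d1 (/ (32 * K1)))).
  assert (0 < / (32 * K1)) by (apply Rinv_0_lt_compat; lra).
  assert (He : 0 < e) by (unfold e; repeat apply Rmin_pos; lra).
  apply (CPS_analytic_at _ _ W (M + M2) K1 e HW' He).
  intros h Hh.
  assert (H1 : Cmod h < d) by (eapply Rlt_le_trans; [exact Hh|apply Rmin_l]).
  assert (H2 : Cmod h < Rmin d1 (/ (32 * K1))) by (eapply Rlt_le_trans; [exact Hh|apply Rmin_r]).
  assert (H3 : Cmod h < d1) by (eapply Rlt_le_trans; [exact H2|apply Rmin_l]).
  assert (H4 : Cmod h < / (32 * K1)) by (eapply Rlt_le_trans; [exact H2|apply Rmin_r]).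
  rewrite Hfa by exact H1.
  rewrite (CPS_exp_log a W (M + M2) K1 h Ha' HW').
  - apply Clog_Cexp. specialize (Hclose h H3). rewrite Cplus_0_l, CPS_0 in Hclose.
    apply Rle_lt_trans with (Rabs (Im (W 0%nat)) + Rabs (Im (CPSeries W h - W 0%nat)%C)).
    + replace (Im (CPSeries W h)) with (Im (W 0%nat) + Im (CPSeries W h - W 0%nat)%C) at 1
        by (unfold Im; simpl; ring). apply Rabs_triang.
    + pose proof (im_le_Cmod (CPSeries W h - W 0%nat)%C).
      change (W 0%nat) with (Clog (a 0%nat)) at 1. unfold eps in Hclose. lra.
  - apply Rmult_lt_reg_r with (/ (32 * K1)); [assumption|].
    replace (32 * K1 * Cmod h * / (32 * K1)) with (Cmod h) by (field; lra). lra.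
  - intros n. rewrite <- (Cconv_CPS_div (CPS_derive a) a n Ha0). unfold Cconv.
    rewrite !sum_n_Cpartial_sum. apply Cpartial_sum_ext. intros k _. unfold W. now rewrite CPS_derive_primitive.
  - apply Cexp_Clog. now rewrite <- Ea.
Qed.

(** * Subordination to the exponential *)

Lemma ray_in_disk z t : unit_disk z -> 0 <= t <= 1 -> unit_disk (t * z)%C.
Proof.
  unfold unit_disk. intros Hz Ht. rewrite Cmod_mult, Cmod_R, Rabs_pos_eq by lra.
  pose proof (Cmod_ge_0 z). nra.
Qed.

Lemma is_derive_RC_ray f z t : analytic_on unit_disk f -> unit_disk z -> 0 <= t <= 1 ->
  is_derive_RC (fun s : R => f (s * z)%C) t (z * C_derive f (t * z))%C.
Proof.
  intros Hf Hz Ht. apply quad_derive_line, analytic_at_quad_derive, Hf. now apply ray_in_disk.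
Qed.

Lemma analytic_on_C_derive D f : analytic_on D f -> analytic_on D (C_derive f).
Proof. intros H z Hz. now apply analytic_at_C_derive, H. Qed.

Lemma Cmod_mul_Cexp_le w r : Cmod w <= r -> r < 1 -> Cmod (w * Cexp w)%C <= exp 1 * r.
Proof.
  intros Hw Hr. rewrite Cmod_mult, Cmod_Cexp, Rmult_comm. pose proof (Cmod_ge_0 w).
  apply Rmult_le_compat; [left; apply exp_pos|lra| |exact Hw].
  left. apply exp_increasing. pose proof (re_le_Cmod w). pose proof (Rle_abs (Re w)). lra.
Qed.

(** The equation on the ray through [z]: [U t = p (t z) - 1] has derivatives
    [z p' (t z)] and [z ^ 2 p'' (t z)], and [w exp w] is bounded by
    [e t Cmod z] at [t z]. *)
Lemma euler_subordinate_bound (gamma1 gamma2 : R) (p : C -> C) :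
  1 < gamma1 -> 0 <= gamma2 -> analytic_on unit_disk p -> p (RtoC 0) = RtoC 1 ->
  subordinate
    (fun z : C => p z + RtoC gamma1 * z * C_derive p z
           + RtoC gamma2 * z ^ 2 * C_derive (C_derive p) z)%C
    (fun z : C => 1 + z * Cexp z)%C ->
  forall z, unit_disk z -> Cmod (p z - 1)%C <= exp 1 / (gamma1 - 1) * Cmod z.
Proof.
  intros Hg1 Hg2 Hp Hp0 (w & _ & _ & _ & Hw & Hq) z Hz.
  pose proof (analytic_on_C_derive _ _ Hp) as Hp1.
  pose proof (analytic_on_C_derive _ _ Hp1) as Hp2.
  replace (exp 1 / (gamma1 - 1) * Cmod z) with (exp 1 * Cmod z / (gamma1 - 1)) by (field; lra).
  replace (p z - 1)%C with (p (1%R * z)%C - 1)%C by (now rewrite Cmult_1_l).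
  apply (euler_ode_bound gamma1 gamma2 (exp 1 * Cmod z)
    (fun t : R => p (t * z) - 1)%C
    (fun t : R => z * C_derive p (t * z))%C
    (fun t : R => z * (z * C_derive (C_derive p) (t * z)))%C
    (fun t : R => w (t * z) * Cexp (w (t * z)))%C); try assumption.
  - apply Rmult_le_pos; [left; apply exp_pos|apply Cmod_ge_0].
  - intros t Ht. destruct (is_derive_RC_ray p z t Hp Hz Ht) as [A B]. split.
    + apply is_derive_ext with (fun s : R => Re (p (s * z)%C) + - 1).
      { intros s. unfold Re. simpl. ring. }
      replace (Re (z * C_derive p (t * z))%C) with (Re (z * C_derive p (t * z))%C + 0) by ring.
      apply is_derive_Rplus; [exact A|apply (is_derive_const (K := R_AbsRing) (V := R_NormedModule))].
    + apply is_derive_ext with (fun s : R => Im (p (s * z)%C)); [|exact B].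
      intros s. unfold Im. simpl. ring.
  - intros t Ht. apply is_derive_RC_scal. now apply is_derive_RC_ray.
  - eexists. apply is_derive_RC_scal, is_derive_RC_scal. apply is_derive_RC_ray; [assumption..|lra].
  - rewrite Cmult_0_l, Hp0. ring.
  - intros t Ht. pose proof (Hq _ (ray_in_disk z t Hz Ht)) as E. simpl in E.
    transitivity ((1 + w (t * z) * Cexp (w (t * z))) - 1)%C; [rewrite <- E|]; ring.
  - intros t Ht. pose proof (ray_in_disk z t Hz Ht) as D. pose proof (Hw _ D) as B.
    eapply Rle_trans; [apply (Cmod_mul_Cexp_le _ _ B D)|].
    rewrite Cmod_mult, Cmod_R, Rabs_pos_eq by lra. right; ring.
Qed.

Lemma subordinate_Cexp_of_close (p : C -> C) : analytic_on unit_disk p ->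
  (forall z, unit_disk z -> Cmod (p z - 1)%C <= / 3 * Cmod z) -> subordinate p Cexp.
Proof.
  intros Hp Hb. exists (fun z => Clog (p z)).
  assert (Hre : forall z, unit_disk z -> 0 < Re (p z)).
  { intros z Hz. specialize (Hb z Hz). unfold unit_disk in Hz.
    pose proof (re_le_Cmod (p z - 1)%C) as H. pose proof (Rle_abs (- Re (p z - 1)%C)) as H'.
    rewrite Rabs_Ropp in H'.
    replace (Re (p z - 1)%C) with (Re (p z) - 1) in * by (unfold Re; simpl; ring). lra. }
  assert (Hw : forall z, unit_disk z -> Cmod (Clog (p z)) <= Cmod z).
  { intros z Hz. specialize (Hb z Hz). unfold unit_disk in Hz.
    set (u := (p z - 1)%C) in *. replace (p z) with (1 + u)%C by (unfold u; ring).
    pose proof (Cmod_ge_0 u).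
    eapply Rle_trans; [apply Cmod_Clog_le; lra|].
    apply Rmult_le_reg_r with (1 - Cmod u); [lra|]. unfold Rdiv.
    rewrite Rmult_assoc, Rinv_l by lra. nra. }
  assert (D0 : unit_disk 0%C) by (unfold unit_disk; rewrite Cmod_0; lra).
  repeat split.
  - intros z Hz. apply analytic_at_Clog; [now apply Hp|now apply Hre].
  - intros z Hz. unfold unit_disk in *. eapply Rle_lt_trans; [now apply Hw|exact Hz].
  - apply Cmod_eq_0, Rle_antisym; [|apply Cmod_ge_0]. generalize (Hw _ D0). now rewrite Cmod_0.
  - exact Hw.
  - intros z Hz. symmetry. apply Cexp_Clog. now apply Hre.
Qed.

Theorem theorem3p2 :
  forall (gamma1 gamma2 : R) (p : C -> C),
    (0 < gamma1)%R -> (0 < gamma2)%R ->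
    (gamma1 - gamma2 - exp 1 * (exp 1 + 1) >= exp 1 ^ 2 \/
     1 - exp 1 * (1 + gamma1 + gamma2) >= exp 1)%R ->
    analytic_on unit_disk p ->
    p (RtoC 0) = RtoC 1 ->
    subordinate
      (fun z : C =>
         p z + RtoC gamma1 * z * C_derive p z
             + RtoC gamma2 * z ^ 2 * C_derive (C_derive p) z)%C
      (fun z : C => 1 + z * Cexp z)%C ->
    subordinate p Cexp.
Proof.
  intros g1 g2 p Hg1 Hg2 Hg Hp Hp0 Hsub.
  assert (He : 2 < exp 1).
  { replace 2 with (1 + 1) by ring. apply exp_ineq1. lra. }
  (* As [exp 1 > 2] and the parameters are positive, the second alternative is
     contradictory; the first one gives [g1 > 2 e ^ 2 + e], and [2 e > 4]. *)
  assert (Hbig : 1 + 3 * exp 1 < g1) by (destruct Hg as [Hg|Hg]; nra).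
  apply subordinate_Cexp_of_close; [exact Hp|].
  intros z Hz. eapply Rle_trans.
  - apply (euler_subordinate_bound g1 g2); try assumption; lra.
  - apply Rmult_le_compat_r; [apply Cmod_ge_0|].
    apply Rmult_le_reg_r with (g1 - 1); [lra|]. unfold Rdiv.
    rewrite Rmult_assoc, Rinv_l by lra. lra.
Qed.
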